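(* Let $\hbar>0$, $\tau,\varsigma>0$, and let $k(x_1,y_1,x_2,y_2)$ be a differentiable kernel on $\mathbb{R}^{4n}$ of cross-Toeplitz type (with parameters $\tau,\varsigma$). Then $k$ is associated to a symbol $\psi$ of a Toeplitz operator through $$\widehat{\psi}(2x_1,2y_1)=\frac{k(x_1,y_1,x_2,y_2)}{[\Lambda_\hbar(0,x_1,y_1)\Phi_{\tau\varsigma}](x_2,y_2)};$$ that is, the right-hand side does not depend on $(x_2,y_2)$ and hence defines a function of $(x_1,y_1)$, which is taken as $\widehat{\psi}(2x_1,2y_1)$.
   Context: Here $\widehat{\psi}$ stands for the symplectic Fourier transform of $\psi$, $\widehat{\psi}(x,y)=(\hbar/2)^n\int_{\mathbb{R}^{2n}}\psi(x',y')e^{\pi i\hbar(x'y-y'x)}dx'dy'$; the association $k\mapsto\psi$ is by the displayed formula for $\widehat{\psi}$. Left pulled action on functions on $\mathbb{R}^{2n}$: $[\Lambda_\hbar(0,x,y)f](x',y')=e^{\pi i\hbar(xy'-yx')}f(x'-x,y'-y)$ (dot products). Mixed Gaussian: $\Phi_{\tau\varsigma}(x,y)=c\,\exp\left(-\frac{\pi\hbar}{\tau+\varsigma}\big(|x|^2+\tau\varsigma|y|^2+i(\tau-\varsigma)\,x\cdot y\big)\right)$, where $c=\left(\frac{4\tau\varsigma}{(\tau+\varsigma)^2}\right)^{n/4}$. Ladder operators, acting on functions of $(x,y)\in\mathbb{R}^{2n}$, for $j=1,\dots,n$: $L^{+}_{R,\tau,j}=\frac{1}{\sqrt{4\pi\hbar\tau}}\left(\pi\hbar(x_j+i\tau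 y_j)+\tau\partial_{x_j}+i\partial_{y_j}\right)$ and $L^{-}_{\Lambda,\varsigma,j}=\frac{1}{\sqrt{4\pi\hbar\varsigma}}\left(\pi\hbar(x_j-i\varsigma y_j)+\varsigma\partial_{x_j}-i\partial_{y_j}\right)$, where $x_j,y_j$ are the $j$-th coordinates. Definition: a kernel $k(x_1,y_1,x_2,y_2)$ on $\mathbb{R}^{4n}$, with each of $x_1,y_1,x_2,y_2\in\mathbb{R}^n$, is of cross-Toeplitz type if, for all $j=1,\dots,n$, it is annihilated by (1) the operators $L^{+}_{R,\tau,j}$ acting in the variables $(x_2,y_2)$; and (2) for each fixed $(x_1,y_1)$, the operators $\Lambda_\hbar(0,x_1,y_1)\circ L^{-}_{\Lambda,\varsigma,j}\circ\Lambda_\hbar(0,-x_1,-y_1)$, where all three factors act in the variables $(x_2,y_2)$. *)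

(* Defs.v *)
From HB Require Import structures.
From mathcomp Require Import all_boot all_order all_algebra.
From mathcomp Require Import complex.
From mathcomp Require Import all_classical all_reals all_analysis.

Set Implicit Arguments.
Unset Strict Implicit.
Unset Printing Implicit Defensive.

Import Order.TTheory GRing.Theory Num.Theory.
Import numFieldNormedType.Exports.

Local Open Scope classical_set_scope.
Local Open Scope ring_scope.
Local Open Scope complex_scope.

(* Functions of (x, y) in R^n x R^n = R^2n, and kernels on R^4n, are curried. *)
Notation phase_fun R n := ('rV[R]_n -> 'rV[R]_n -> R[i]) (only parsing).
Notation kernel4 R n :=
  ('rV[R]_n -> 'rV[R]_n -> 'rV[R]_n -> 'rV[R]_n -> R[i]) (only parsing).

Section PhaseSpace.
Variable R : realType.

Definition cexp (z : R[i]) : R[i] :=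
  (expR (complex.Re z))%:C * (cos (complex.Im z) +i* sin (complex.Im z)).

Variable n : nat.
Implicit Types (x y : 'rV[R]_n) (hbar tau vsig : R) (f : phase_fun R n).

Definition dot x y : R := \sum_(j < n) x 0 j * y 0 j.

(* R[i] is not declared as a normed space over R, so real derivatives are
   taken on real and imaginary parts. *)
Definition dx (j : 'I_n) f x y : R[i] :=
  'D_(delta_mx 0 j) (fun u => complex.Re (f u y)) x
  +i* 'D_(delta_mx 0 j) (fun u => complex.Im (f u y)) x.

Definition dy (j : 'I_n) f x y : R[i] := dx j (fun v u => f u v) y x.

(* Lambda_hbar at the Heisenberg group element (0, x, y): the 0 is the central
   coordinate. *)
Definition Lambda0 hbar x y f : phase_fun R n := fun x' y' =>
  cexp ('i%C * (pi * hbar * (dot x y' - dot y x'))%:C) * f (x' - x) (y' - y).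

Definition mixed_gaussian hbar tau vsig : phase_fun R n := fun x y =>
  ((4 * tau * vsig / (tau + vsig) ^+ 2) `^ (n%:R / 4))%:C *
  cexp (- (pi * hbar / (tau + vsig))%:C *
    ((dot x x + tau * vsig * dot y y)%:C
     + 'i%C * ((tau - vsig) * dot x y)%:C)).

Definition LRplus hbar tau (j : 'I_n) f : phase_fun R n := fun x y =>
  ((Num.sqrt (4 * pi * hbar * tau))^-1)%:C *
  ((pi * hbar)%:C * ((x 0 j)%:C + 'i%C * (tau * y 0 j)%:C) * f x y
   + tau%:C * dx j f x y + 'i%C * dy j f x y).

Definition LLminus hbar vsig (j : 'I_n) f : phase_fun R n := fun x y =>
  ((Num.sqrt (4 * pi * hbar * vsig))^-1)%:C *
  ((pi * hbar)%:C * ((x 0 j)%:C - 'i%C * (vsig * y 0 j)%:C) * f x y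
   + vsig%:C * dx j f x y - 'i%C * dy j f x y).

Definition cross_toeplitz_type hbar tau vsig (k : kernel4 R n) : Prop :=
  forall j : 'I_n,
    (forall x1 y1 x2 y2, LRplus hbar tau j (k x1 y1) x2 y2 = 0) /\
    (forall x1 y1 x2 y2,
      Lambda0 hbar x1 y1
        (LLminus hbar vsig j (Lambda0 hbar (- x1) (- y1) (k x1 y1))) x2 y2 = 0).

Definition differentiable_kernel (k : kernel4 R n) : Prop :=
  let V := ('rV[R]_n * 'rV[R]_n * 'rV[R]_n * 'rV[R]_n)%type in
  forall p : V,
    differentiable
      (fun q : V => complex.Re (k q.1.1.1 q.1.1.2 q.1.2 q.2)) p /\
    differentiable
      (fun q : V => complex.Im (k q.1.1.1 q.1.1.2 q.1.2 q.2)) p.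

End PhaseSpace.

Section Fourier.
Variable R : realType.

(* Lebesgue integral on R^m as an iterated one-dimensional integral; for
   Borel functions that are nonnegative or absolutely integrable this is the
   integral against Lebesgue measure, by Tonelli and Fubini. *)
Fixpoint iterated_integral (m : nat) : ('rV[R]_m -> \bar R) -> \bar R :=
  match m with
  | 0 => fun g => g 0
  | m'.+1 => fun g =>
      (\int[lebesgue_measure]_(t in [set: R])
         iterated_integral
           (fun v : 'rV[R]_m' => g (row_mx (t%:M : 'rV[R]_1) v)))%E
  end.

Variable n : nat.
Implicit Types (f : phase_fun R n).

Definition on_rV (g : 'rV[R]_n -> 'rV[R]_n -> R) (v : 'rV[R]_(n + n)) : R :=
  g (lsubmx v) (rsubmx v).

Definition borel_rV (m : nat) (g : 'rV[R]_m -> R) : Prop :=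
  measurable_fun [set: m.-tuple R] (fun t => g (\row_i tnth t i)).

(* The norm of R[i] takes values in R[i], hence the real part. *)
Definition integrable2 f : Prop :=
  [/\ borel_rV (on_rV (fun x y => complex.Re (f x y))),
      borel_rV (on_rV (fun x y => complex.Im (f x y))) &
      (iterated_integral
         (fun v => (on_rV (fun x y => complex.Re `|f x y|) v)%:E) < +oo)%E].

Definition integral2 f : R[i] :=
  fine (iterated_integral
          (fun v => (on_rV (fun x y => complex.Re (f x y)) v)%:E))
  +i* fine (iterated_integral
          (fun v => (on_rV (fun x y => complex.Im (f x y)) v)%:E)).

Definition symplectic_fourier (hbar : R) f : phase_fun R n := fun x y =>
  ((hbar / 2) ^+ n)%:C *
  integral2 (fun x' y' =>
    f x' y' * cexp ('i%C * (pi * hbar * (dot x' y - dot y' x))%:C)).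

(* The quotient makes sense: Lambda0 of the mixed Gaussian vanishes nowhere. *)
Definition symbol_transform (hbar tau vsig : R) (k : kernel4 R n)
    (psihat : phase_fun R n) : Prop :=
  forall x1 y1 x2 y2 : 'rV[R]_n,
    psihat (2 *: x1) (2 *: y1) =
    k x1 y1 x2 y2 / Lambda0 hbar x1 y1 (mixed_gaussian hbar tau vsig) x2 y2.

(* Integrability makes the integral defining the transform of psi converge.  A
   kernel need not have a symbol in this class: its transform psihat can be an
   arbitrary differentiable function, and psi is then only a formal object. *)
Definition toeplitz_symbol (hbar tau vsig : R) (k : kernel4 R n)
    (psi : phase_fun R n) : Prop :=
  integrable2 psi /\
  symbol_transform hbar tau vsig k (symplectic_fourier hbar psi).

End Fourier.

(* Main.v *)
(* Pull the slice f = k(x1, y1, ., .) back to h = Lambda(0, -x1, -y1) f.  The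
   right-invariant operators L^+_R commute with Lambda, so h is annihilated by
   both L^+_R and L^-_Lambda; in each coordinate j these two equations form a
   linear system in (d_x h, d_y h) with determinant proportional to
   tau + vsig > 0.  Its solution is grad h = - (grad E) h, where E is the
   quadratic exponent with Phi = c exp(-E).  Hence h exp(E) has zero partial
   derivatives and is constant, and it equals c k / (Lambda Phi) after
   translation. *)
Require Import Defs.
From mathcomp Require Import all_boot all_order all_algebra.
From mathcomp Require Import complex.
From mathcomp Require Import all_classical all_reals all_analysis.
From mathcomp Require Import ring.
Import Order.TTheory GRing.Theory Num.Theory.
Import numFieldNormedType.Exports.
Local Open Scope ring_scope.
Local Open Scope complex_scope.

Set Implicit Arguments.
Unset Strict Implicit.
Unset Printing Implicit Defensive.

(** * The complex exponential as a homomorphism *)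

Section ComplexExponential.
Variable R : realType.
Implicit Types z w : R[i].

Lemma cexpD z w : cexp (z + w) = cexp z * cexp w.
Proof.
case: z w => [a b] [c d]; rewrite /cexp; simpc => /=.
by rewrite expRD cosD sinD; apply/eqP; rewrite eq_complex /=;
  apply/andP; split; apply/eqP; ring.
Qed.

Lemma cexp0 : cexp (0 : R[i]) = 1.
Proof. by rewrite /cexp /= expR0 cos0 sin0; simpc. Qed.

Lemma cexpNK z : cexp (- z) * cexp z = 1.
Proof. by rewrite -cexpD addNr cexp0. Qed.

Lemma cexp_neq0 z : cexp z != 0.
Proof.
by apply: contraTneq (oner_neq0 R[i]) => z0; rewrite -(cexpNK z) z0 mulr0 eqxx.
Qed.

Lemma cexpN z : cexp (- z) = (cexp z)^-1.
Proof. by apply: (mulIf (cexp_neq0 z)); rewrite cexpNK mulVf ?cexp_neq0. Qed.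

End ComplexExponential.

(** * Directional derivatives of complex-valued functions of real vectors *)

Section DirectionalDerivative.
Variables (R : realType) (V : normedModType R).
Implicit Types (x v a : V) (g : V -> R) (F G : V -> R[i]) (d e : R[i]).

Lemma is_derive_shift g x v a (dg : R) :
  is_derive (x + a) v g dg -> is_derive x v (fun u => g (u + a)) dg.
Proof.
have E : (fun h : R => h^-1 *: (((fun u => g (u + a)) \o shift x) (h *: v) - g (x + a)))
    = (fun h : R => h^-1 *: ((g \o shift (x + a)) (h *: v) - g (x + a))).
  by apply/funext => h /=; rewrite addrA.
by case=> dg1 dg2; split; [rewrite /derivable E | rewrite /derive E].
Qed.

(** Both difference quotients are the same function of [h]. This carries one-variable results, the
    chain rule and constancy under zero derivative, over to directional derivatives. *)
Lemma is_derive_line g x v (t dg : R) :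
  is_derive t 1 (fun s : R => g (s *: v + x)) dg <-> is_derive (t *: v + x) v g dg.
Proof.
have E : (fun h : R => h^-1 *: (((fun s : R => g (s *: v + x)) \o shift t) (h *: 1) -
      g (t *: v + x)))
    = (fun h : R => h^-1 *: ((g \o shift (t *: v + x)) (h *: v) - g (t *: v + x))).
  by apply/funext => h /=; rewrite scalerDl addrA [h *: (1 : R)]mulr1.
split; case; rewrite /derivable /derive => dg1 dg2; split;
  rewrite /derivable /derive.
- by rewrite -E.
- by rewrite -E.
- by rewrite E.
- by rewrite E.
Qed.

Lemma is_derive_line0 g x v (dg : R) :
  is_derive (0 : R) 1 (fun s : R => g (s *: v + x)) dg <-> is_derive x v g dg.
Proof. by rewrite is_derive_line scale0r add0r. Qed.

Lemma is_derive_comp_real (phi : R -> R) g x v (dphi dg : R) :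
  is_derive (g x) 1 phi dphi -> is_derive x v g dg ->
  is_derive x v (fun u => phi (g u)) (dphi * dg).
Proof.
move=> Hphi /is_derive_line0 Hg; apply/is_derive_line0.
apply: (@is_derive1_comp _ phi (fun s : R => g (s *: v + x)) 0) => //.
by rewrite scale0r add0r.
Qed.

(** Differentiation by parts matches [dx] and [dy]. The direction [v] is real, so no holomorphy is
    involved. *)
Definition is_cderive x v F d :=
  is_derive x v (fun u => complex.Re (F u)) (complex.Re d) /\
  is_derive x v (fun u => complex.Im (F u)) (complex.Im d).

Lemma is_cderive_eq x v F d e : is_cderive x v F d -> d = e -> is_cderive x v F e.
Proof. by move=> ? <-. Qed.

Lemma is_cderive_shift F x v a d :
  is_cderive (x + a) v F d -> is_cderive x v (fun u => F (u + a)) d.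
Proof.
by case=> dRe dIm; split;
  [exact: (is_derive_shift dRe) | exact: (is_derive_shift dIm)].
Qed.

Lemma is_cderive_cst x v d : is_cderive x v (fun=> d) 0.
Proof. by split; exact: is_derive_cst. Qed.

Lemma is_cderive_real x v g (dg : R) :
  is_derive x v g dg -> is_cderive x v (fun u => (g u)%:C) dg%:C.
Proof. by move=> ?; split => //=; exact: is_derive_cst. Qed.

Lemma is_cderiveD x v F G d e :
  is_cderive x v F d -> is_cderive x v G e ->
  is_cderive x v (fun u => F u + G u) (d + e).
Proof.
move=> [F1 F2] [G1 G2]; split.
- have -> : (fun u => complex.Re (F u + G u)) =
    (fun u => complex.Re (F u)) + (fun u => complex.Re (G u)).
    by apply/funext => u; rewrite raddfD.
  by rewrite raddfD; exact: is_deriveD.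
- have -> : (fun u => complex.Im (F u + G u)) =
    (fun u => complex.Im (F u)) + (fun u => complex.Im (G u)).
    by apply/funext => u; rewrite raddfD.
  by rewrite raddfD; exact: is_deriveD.
Qed.

Lemma is_cderiveM x v F G d e :
  is_cderive x v F d -> is_cderive x v G e ->
  is_cderive x v (fun u => F u * G u) (d * G x + F x * e).
Proof.
move=> [F1 F2] [G1 G2]; split.
- have -> : (fun u => complex.Re (F u * G u)) =
    (fun u => complex.Re (F u)) * (fun u => complex.Re (G u)) -
    (fun u => complex.Im (F u)) * (fun u => complex.Im (G u)).
    by apply/funext => u; rewrite !fctE; case: (F u) (G u) => [? ?] [? ?]; simpc.
  apply: is_derive_eq.
  rewrite /GRing.scale /=; case: (F x) (G x) d e {F1 F2 G1 G2} => [? ?] [? ?] [? ?] [? ?].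
  by simpc => /=; ring.
- have -> : (fun u => complex.Im (F u * G u)) =
    (fun u => complex.Re (F u)) * (fun u => complex.Im (G u)) +
    (fun u => complex.Im (F u)) * (fun u => complex.Re (G u)).
    by apply/funext => u; rewrite !fctE; case: (F u) (G u) => [? ?] [? ?]; simpc.
  apply: is_derive_eq.
  rewrite /GRing.scale /=; case: (F x) (G x) d e {F1 F2 G1 G2} => [? ?] [? ?] [? ?] [? ?].
  by simpc => /=; ring.
Qed.

Lemma is_cderiveZ x v F d e :
  is_cderive x v F d -> is_cderive x v (fun u => e * F u) (e * d).
Proof.
move=> HF; apply: is_cderive_eq (is_cderiveM (is_cderive_cst x v e) HF) _.
by rewrite mul0r add0r.
Qed.

(** The modulus and the phase factor are differentiated separately by the real chain rule; the
    product rule then reassembles [d] from its real and imaginary parts. *)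
Lemma is_cderive_cexp x v F d :
  is_cderive x v F d ->
  is_cderive x v (fun u => cexp (F u)) (d * cexp (F x)).
Proof.
move=> [F1 F2].
have Hexp := is_cderive_real (is_derive_comp_real (is_derive_expR _) F1).
have Hcis : is_cderive x v
    (fun u => cos (complex.Im (F u)) +i* sin (complex.Im (F u)))
    ('i%C * (complex.Im d)%:C *
     (cos (complex.Im (F x)) +i* sin (complex.Im (F x)))).
  split => /=.
  - apply: is_derive_eq (is_derive_comp_real (is_derive_cos _) F2) _; ring.
  - apply: is_derive_eq (is_derive_comp_real (is_derive_sin _) F2) _; ring.
apply: is_cderive_eq (is_cderiveM Hexp Hcis) _.
rewrite /cexp {3}(complexE d); case: d F1 F2 Hexp Hcis => [p q] /= _ _ _ _.
rewrite rmorphM /=; ring.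
Qed.

End DirectionalDerivative.

(** * Coordinate derivatives, the dot product and slices of kernels *)

Section RowVectors.
Variables (R : realType) (n : nat).
Implicit Types (x y : 'rV[R]_n) (j : 'I_n) (f : 'rV[R]_n -> 'rV[R]_n -> R[i]).

(** Such a [g] is constant on every line parallel to an axis, and any point is reached from the
    origin by adding its coordinates one at a time. *)
Lemma is_derive_rV_cst (g : 'rV[R]_n -> R) x y :
  (forall z j, is_derive z 'e_j g 0) -> g x = g y.
Proof.
move=> g0.
have step a j z : g (a *: 'e_j + z) = g z.
  have := is_derive_0_is_cst a 0 (fun t => (is_derive_line g z 'e_j t 0).2 (g0 _ j)).
  by rewrite scale0r add0r.
suff cst z : g z = g 0 by rewrite !cst.
rewrite [z]row_sum_delta.
by elim/big_rec : _ => [|j w _ IH]; rewrite // step.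
Qed.

Lemma is_cderive_rV_cst (F : 'rV[R]_n -> R[i]) x y :
  (forall z j, is_cderive z 'e_j F 0) -> F x = F y.
Proof.
move=> F0; rewrite [F x]complexE [F y]complexE.
congr (_%:C + _ * _%:C).
- by apply: (@is_derive_rV_cst (fun u => complex.Re (F u))) => z j; case: (F0 z j).
- by apply: (@is_derive_rV_cst (fun u => complex.Im (F u))) => z j; case: (F0 z j).
Qed.

Lemma dotC x y : dot x y = dot y x.
Proof. by apply: eq_bigr => j _; rewrite mulrC. Qed.

Lemma dotDl x y z : dot (x + y) z = dot x z + dot y z.
Proof. by rewrite -big_split; apply: eq_bigr => j _; rewrite mxE mulrDl. Qed.

Lemma dotNl x z : dot (- x) z = - dot x z.
Proof. by rewrite -sumrN; apply: eq_bigr => j _; rewrite mxE mulNr. Qed.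

Lemma dotZl a x z : dot (a *: x) z = a * dot x z.
Proof. by rewrite mulr_sumr; apply: eq_bigr => j _; rewrite mxE mulrA. Qed.

Lemma dot_delta j x : dot 'e_j x = x 0 j.
Proof.
rewrite /dot (bigD1 j) //= mxE !eqxx mul1r big1 ?addr0 // => i /negbTE ij.
by rewrite mxE ij andbF mul0r.
Qed.

Lemma is_derive_dotl x y j : is_derive x 'e_j (fun u => dot u y) (y 0 j).
Proof.
apply/is_derive_line0.
have -> : (fun t : R => dot (t *: 'e_j + x) y) = (fun t => t * y 0 j + dot x y).
  by apply/funext => t; rewrite dotDl dotZl dot_delta.
by apply: is_derive_eq; rewrite /GRing.scale /= mulr0 mulr1 add0r addr0.
Qed.

Lemma is_derive_dotr x y j : is_derive x 'e_j (fun u => dot y u) (y 0 j).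
Proof.
have -> : (fun u => dot y u) = (fun u => dot u y) by apply/funext => u; exact: dotC.
exact: is_derive_dotl.
Qed.

Lemma is_derive_dot_diag x j : is_derive x 'e_j (fun u => dot u u) (2 * x 0 j).
Proof.
apply/is_derive_line0.
have -> : (fun t : R => dot (t *: 'e_j + x) (t *: 'e_j + x)) =
    (fun t => t * t + t * (2 * x 0 j) + dot x x).
  apply/funext => t; rewrite dotDl dotZl dot_delta (dotC x) dotDl dotZl dot_delta.
  by rewrite !mxE !eqxx /=; ring.
by apply: is_derive_eq; rewrite /GRing.scale /= mulr0 mul0r mulr1 !add0r addr0.
Qed.

Lemma dxE j f x y d : is_cderive x 'e_j (f ^~ y) d -> dx j f x y = d.
Proof. by case=> d1 d2; rewrite /dx !derive_val; case: d {d1 d2}. Qed.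

Lemma dyE j f x y d : is_cderive y 'e_j (f x) d -> dy j f x y = d.
Proof. exact: (@dxE j (fun v u => f u v)). Qed.

(** Joint differentiability is composed with the embedding of one block of variables, the other
    three being frozen. *)
Lemma differentiable_kernel_dx (k : kernel4 R n) x1 y1 x y j :
  differentiable_kernel k ->
  is_cderive x 'e_j (k x1 y1 ^~ y) (dx j (k x1 y1) x y).
Proof.
move=> kd; have [kRe kIm] := kd (x1, y1, x, y).
have ad : differentiable (fun u : 'rV[R]_n => (x1, y1, u, y)) x.
  apply: differentiable_pair => //; exact: differentiable_pair.
by split; apply: DeriveDef => //; apply: diff_derivable;
  [exact: (differentiable_comp ad kRe) | exact: (differentiable_comp ad kIm)].
Qed.

Lemma differentiable_kernel_dy (k : kernel4 R n) x1 y1 x y j :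
  differentiable_kernel k ->
  is_cderive y 'e_j (k x1 y1 x) (dy j (k x1 y1) x y).
Proof.
move=> kd; have [kRe kIm] := kd (x1, y1, x, y).
have ad : differentiable (fun u : 'rV[R]_n => (x1, y1, x, u)) y by exact: differentiable_pair.
by split; apply: DeriveDef => //; apply: diff_derivable;
  [exact: (differentiable_comp ad kRe) | exact: (differentiable_comp ad kIm)].
Qed.

End RowVectors.

(** * The ladder equations and the Gaussian quotient *)

Section CrossToeplitz.
Variables (R : realType) (n : nat) (hbar tau vsig : R).
Hypotheses (hbar_gt0 : 0 < hbar) (tau_gt0 : 0 < tau) (vsig_gt0 : 0 < vsig).
Implicit Types (a b x y u v : 'rV[R]_n) (j : 'I_n) (f : 'rV[R]_n -> 'rV[R]_n -> R[i]).

(** Taken with a plus sign, so that division by the Gaussian becomes multiplication by [cexp] of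
    this exponent. *)
Definition gaussian_exponent x y : R[i] :=
  (pi * hbar / (tau + vsig))%:C *
    ((dot x x + tau * vsig * dot y y)%:C
     + 'i%C * ((tau - vsig) * dot x y)%:C).

Lemma is_cderive_gaussian_exponent_l x y j :
  is_cderive x 'e_j (gaussian_exponent ^~ y)
    ((pi * hbar / (tau + vsig))%:C *
      ((2 * x 0 j)%:C + 'i%C * ((tau - vsig) * y 0 j)%:C)).
Proof.
apply/is_cderiveZ/is_cderiveD; last first.
  apply/is_cderiveZ/is_cderive_real.
  have H := is_derive_dotl x y j.
  exact: is_deriveZ.
apply: is_cderive_real.
have H := is_derive_dot_diag x j.
apply: is_derive_eq (is_deriveD H (is_derive_cst (tau * vsig * dot y y) _ _)) _.
exact: addr0.
Qed.

Lemma is_cderive_gaussian_exponent_r x y j :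
  is_cderive y 'e_j (gaussian_exponent x)
    ((pi * hbar / (tau + vsig))%:C *
      ((2 * tau * vsig * y 0 j)%:C + 'i%C * ((tau - vsig) * x 0 j)%:C)).
Proof.
apply/is_cderiveZ/is_cderiveD; last first.
  apply/is_cderiveZ/is_cderive_real.
  have H := is_derive_dotr y x j.
  exact: is_deriveZ.
apply: is_cderive_real.
have H := is_deriveZ (tau * vsig) (is_derive_dot_diag y j).
apply: is_derive_eq (is_deriveD (is_derive_cst (dot x x) _ _) H) _.
by rewrite /GRing.scale /=; ring.
Qed.

(** The phase depends on [x] only through [- dot b x], which yields the extra term. The phase factor
    stays outside, common to all terms of a ladder equation. *)
Lemma is_cderive_Lambda0_l a b f x y j d :
  is_cderive (x - a) 'e_j (f ^~ (y - b)) d ->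
  is_cderive x 'e_j ((Lambda0 hbar a b f) ^~ y)
    (cexp ('i%C * (pi * hbar * (dot a y - dot b x))%:C) *
     (d - 'i%C * (pi * hbar * b 0 j)%:C * f (x - a) (y - b))).
Proof.
move=> Hf; have Hp : is_cderive x 'e_j
    (fun u => 'i%C * (pi * hbar * (dot a y - dot b u))%:C)
    ('i%C * (pi * hbar * (- b 0 j))%:C).
  apply/is_cderiveZ/is_cderive_real.
  have H := is_deriveB (is_derive_cst (dot a y) x 'e_j) (is_derive_dotr x b j).
  by apply: is_derive_eq (is_deriveZ (pi * hbar) H) _; rewrite sub0r.
apply: is_cderive_eq (is_cderiveM (is_cderive_cexp Hp) (is_cderive_shift Hf)) _.
ring.
Qed.

Lemma is_cderive_Lambda0_r a b f x y j d :
  is_cderive (y - b) 'e_j (f (x - a)) d ->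
  is_cderive y 'e_j (Lambda0 hbar a b f x)
    (cexp ('i%C * (pi * hbar * (dot a y - dot b x))%:C) *
     (d + 'i%C * (pi * hbar * a 0 j)%:C * f (x - a) (y - b))).
Proof.
move=> Hf; have Hp : is_cderive y 'e_j
    (fun u => 'i%C * (pi * hbar * (dot a u - dot b x))%:C)
    ('i%C * (pi * hbar * a 0 j)%:C).
  apply/is_cderiveZ/is_cderive_real.
  have H := is_deriveB (is_derive_dotr y a j) (is_derive_cst (dot b x) y 'e_j).
  by apply: is_derive_eq (is_deriveZ (pi * hbar) H) _; rewrite subr0.
apply: is_cderive_eq (is_cderiveM (is_cderive_cexp Hp) (is_cderive_shift Hf)) _.
ring.
Qed.

(** With [P] and [Q] the two left-hand sides, [P + Q] eliminates [hy] and [vsig * P - tau * Q]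
    eliminates [hx]. The surviving unknown has coefficient [tau + vsig], respectively
    ['i * (tau + vsig)]. *)
Lemma ladder_system (c p q : R) (h hx hy : R[i]) :
  c%:C * (p%:C + 'i%C * (tau * q)%:C) * h + tau%:C * hx + 'i%C * hy = 0 ->
  c%:C * (p%:C - 'i%C * (vsig * q)%:C) * h + vsig%:C * hx - 'i%C * hy = 0 ->
  hx = - ((c / (tau + vsig))%:C *
    ((2 * p)%:C + 'i%C * ((tau - vsig) * q)%:C)) * h /\
  hy = - ((c / (tau + vsig))%:C *
    ((2 * tau * vsig * q)%:C + 'i%C * ((tau - vsig) * p)%:C)) * h.
Proof.
set P := (X in X = 0 -> _ -> _); set Q := (X in _ -> X = 0 -> _) => P0 Q0.
have s0 : (tau%:C + vsig%:C : R[i]) != 0.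
  by rewrite -rmorphD /= fmorph_eq0 gt_eqF ?addr_gt0.
have I2 := sqr_i R.
rewrite !fmorph_div /= !rmorphD /=.
split; apply/eqP; rewrite -subr_eq0; apply/eqP.
- transitivity ((P + Q) / (tau%:C + vsig%:C)); last by rewrite P0 Q0 addr0 mul0r.
  by rewrite /P /Q; field.
- transitivity (- 'i%C * (vsig%:C * P - tau%:C * Q) / (tau%:C + vsig%:C)).
    by rewrite /P /Q; field: I2.
  by rewrite P0 Q0 !mulr0 subr0 mulr0 mul0r.
Qed.

Lemma LRplus_eq0 j f x y : LRplus hbar tau j f x y = 0 ->
  (pi * hbar)%:C * ((x 0 j)%:C + 'i%C * (tau * y 0 j)%:C) * f x y
   + tau%:C * dx j f x y + 'i%C * dy j f x y = 0.
Proof.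
move=> /eqP; rewrite mulf_eq0 fmorph_eq0 invr_eq0 sqrtr_eq0 leNgt.
by rewrite !mulr_gt0 ?pi_gt0 //= => /eqP.
Qed.

Lemma LLminus_eq0 j f x y : LLminus hbar vsig j f x y = 0 ->
  (pi * hbar)%:C * ((x 0 j)%:C - 'i%C * (vsig * y 0 j)%:C) * f x y
   + vsig%:C * dx j f x y - 'i%C * dy j f x y = 0.
Proof.
move=> /eqP; rewrite mulf_eq0 fmorph_eq0 invr_eq0 sqrtr_eq0 leNgt.
by rewrite !mulr_gt0 ?pi_gt0 //= => /eqP.
Qed.

(** The logarithmic derivatives of [f] and of [cexp (gaussian_exponent _ _)] are opposite, so the
    product has zero gradient. The first block of variables is moved to the origin, then the
    second. *)
Lemma gaussian_quotient_cst f x y :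
  (forall u v j, is_cderive u 'e_j (f ^~ v)
    (- ((pi * hbar / (tau + vsig))%:C *
        ((2 * u 0 j)%:C + 'i%C * ((tau - vsig) * v 0 j)%:C)) * f u v)) ->
  (forall u v j, is_cderive v 'e_j (f u)
    (- ((pi * hbar / (tau + vsig))%:C *
        ((2 * tau * vsig * v 0 j)%:C + 'i%C * ((tau - vsig) * u 0 j)%:C)) * f u v)) ->
  f x y * cexp (gaussian_exponent x y) = f 0 0 * cexp (gaussian_exponent 0 0).
Proof.
move=> fx fy; transitivity (f 0 y * cexp (gaussian_exponent 0 y)).
- apply: (is_cderive_rV_cst (F := fun u => f u y * cexp (gaussian_exponent u y))) => u j.
  apply: is_cderive_eq (is_cderiveM (fx u y j)
    (is_cderive_cexp (is_cderive_gaussian_exponent_l u y j))) _.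
  ring.
- apply: (is_cderive_rV_cst (F := fun v => f 0 v * cexp (gaussian_exponent 0 v))) => v j.
  apply: is_cderive_eq (is_cderiveM (fy 0 v j)
    (is_cderive_cexp (is_cderive_gaussian_exponent_r 0 v j))) _.
  ring.
Qed.

(** The translations cancel, and the two [dot a b] terms in the phase cancel by symmetry. *)
Lemma Lambda0K a b f x y :
  Lambda0 hbar (- a) (- b) f (x - a) (y - b) =
  cexp (- ('i%C * (pi * hbar * (dot a y - dot b x))%:C)) * f x y.
Proof.
rewrite /Lambda0 !opprK !subrK; congr (cexp _ * _).
rewrite !dotNl !(dotC _ (_ - _)) !dotDl !dotNl (dotC a b) !(dotC _ a) !(dotC _ b).
ring.
Qed.

Lemma cross_toeplitz_quotient (k : kernel4 R n) a b x y :
  differentiable_kernel k -> cross_toeplitz_type hbar tau vsig k ->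
  Lambda0 hbar (- a) (- b) (k a b) x y * cexp (gaussian_exponent x y) =
  Lambda0 hbar (- a) (- b) (k a b) 0 0 * cexp (gaussian_exponent 0 0).
Proof.
move=> kd kT.
pose h := Lambda0 hbar (- a) (- b) (k a b).
have hx u v j := is_cderive_Lambda0_l (differentiable_kernel_dx a b (u - - a) (v - - b) j kd).
have hy u v j := is_cderive_Lambda0_r (differentiable_kernel_dy a b (u - - a) (v - - b) j kd).
have gradient u v j :
    dx j h u v = - ((pi * hbar / (tau + vsig))%:C *
        ((2 * u 0 j)%:C + 'i%C * ((tau - vsig) * v 0 j)%:C)) * h u v /\
    dy j h u v = - ((pi * hbar / (tau + vsig))%:C *
        ((2 * tau * vsig * v 0 j)%:C + 'i%C * ((tau - vsig) * u 0 j)%:C)) * h u v.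
  have [/(_ a b (u - - a) (v - - b))/LRplus_eq0 kR] := kT j.
  move=> /(_ a b (u + a) (v + b))/eqP.
  rewrite mulf_eq0 (negbTE (cexp_neq0 _)) /= !addrK => /eqP/LLminus_eq0 kL.
  apply: ladder_system => //.
  (* This is the commutation of [LRplus] with [Lambda0]: differentiating the phase adds
     [pi * hbar * (a_j + i tau b_j)] to the coefficient of [F], exactly the change from [(u, v)] to
     [(u + a, v + b)]. The goal is thus [c] times [kR]. *)
  rewrite /h (dxE (hx u v j)) (dyE (hy u v j)) /Lambda0.
  set c := cexp _; move: kR; set F := k a b _ _; set Fx := dx _ _ _ _.
  set Fy := dy _ _ _ _ => kR.
  rewrite -[RHS](mulr0 c) -kR !mxE; ring: (sqr_i R).
apply: (gaussian_quotient_cst (f := h)) => u v j.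
- by rewrite -(gradient u v j).1 (dxE (hx u v j)); exact: hx.
- by rewrite -(gradient u v j).2 (dyE (hy u v j)); exact: hy.
Qed.

Lemma Lambda0_mixed_gaussian a b x y :
  Lambda0 hbar a b (mixed_gaussian hbar tau vsig) x y =
  ((4 * tau * vsig / (tau + vsig) ^+ 2) `^ (n%:R / 4))%:C *
  (cexp ('i%C * (pi * hbar * (dot a y - dot b x))%:C) /
   cexp (gaussian_exponent (x - a) (y - b))).
Proof.
rewrite /Lambda0 /mixed_gaussian mulNr cexpN; exact: mulrCA.
Qed.

Lemma cross_toeplitz_symbol_cst (k : kernel4 R n) a b x y x' y' :
  differentiable_kernel k -> cross_toeplitz_type hbar tau vsig k ->
  k a b x y / Lambda0 hbar a b (mixed_gaussian hbar tau vsig) x y =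
  k a b x' y' / Lambda0 hbar a b (mixed_gaussian hbar tau vsig) x' y'.
Proof.
move=> kd kT.
(* The common value is that of the pulled-back slice at the origin, divided by the constant of the
   Gaussian. *)
suff E u v : k a b u v / Lambda0 hbar a b (mixed_gaussian hbar tau vsig) u v =
    Lambda0 hbar (- a) (- b) (k a b) 0 0 * cexp (gaussian_exponent 0 0) /
    ((4 * tau * vsig / (tau + vsig) ^+ 2) `^ (n%:R / 4))%:C by rewrite !E.
(* Moving the base point from the origin to [(u - a, v - b)] makes the phase from [Lambda0K] match
   the one in the denominator. *)
rewrite -(cross_toeplitz_quotient a b (u - a) (v - b) kd kT).
rewrite Lambda0K Lambda0_mixed_gaussian cexpN.
set c := (_ `^ _)%:C; set e := cexp _; set g := cexp _.
by rewrite (invfM c) invf_div; ring.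
Qed.

End CrossToeplitz.

Theorem lemma6p19 (R : realType) (n : nat) (hbar tau vsig : R)
    (k : 'rV[R]_n -> 'rV[R]_n -> 'rV[R]_n -> 'rV[R]_n -> R[i]) :
  0 < hbar -> 0 < tau -> 0 < vsig ->
  differentiable_kernel k ->
  cross_toeplitz_type hbar tau vsig k ->
  exists psihat : 'rV[R]_n -> 'rV[R]_n -> R[i],
    unique (symbol_transform hbar tau vsig k) psihat /\
    (forall psi : 'rV[R]_n -> 'rV[R]_n -> R[i],
       toeplitz_symbol hbar tau vsig k psi <->
       integrable2 psi /\ symplectic_fourier hbar psi = psihat).
Proof.
move=> hbar_gt0 tau_gt0 vsig_gt0 kd kT.
(* Halving undoes the doubled arguments of the transform; the choice of [(0, 0)] for the last two
   variables is immaterial by constancy of the quotient. *)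
pose half (u : 'rV[R]_n) := 2^-1 *: u.
pose psihat u v := k (half u) (half v) 0 0 /
  Lambda0 hbar (half u) (half v) (mixed_gaussian hbar tau vsig) 0 0.
have psihatP : symbol_transform hbar tau vsig k psihat.
  move=> x1 y1 x2 y2; rewrite /psihat /half !scalerA mulVf ?pnatr_eq0 // !scale1r.
  exact: cross_toeplitz_symbol_cst.
(* Every pair [(u, v)] is the double of another, so the quotient formula fixes the transform
   everywhere. *)
have psihat_uniq phi : symbol_transform hbar tau vsig k phi -> psihat = phi.
  move=> phiP; apply/funext => u; apply/funext => v.
  by rewrite /psihat -(phiP _ _ 0 0) !scalerA mulfV ?pnatr_eq0 // !scale1r.
exists psihat; split=> // psi; split=> -[psi_int].
- by move=> /psihat_uniq.
- by move=> psiE; split=> //; rewrite psiE.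
Qed.
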